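(* Consider the shifted mean detection problem with $n$ independent observations and $\mathcal{C}$ the class of all perfect matchings of the complete balanced bipartite graph with $2\sqrt d$ nodes (so $s^*=\sqrt d$). Suppose one of the following holds: (i) $\beta^{*2}\alpha^2n=o(1)$ and $\beta^{*2}s^*=o(1)$; (ii) $\beta^*=o(1)$ and $\beta^{*2}\alpha n=o(1)$. Then for $\delta$ a sufficiently small positive constant, $\inf_{\phi}R(\phi)\ge1-\delta$ for $s^*,d,n$ sufficiently large, where the infimum is over all tests $\phi$.
   Context: Setting: $\sqrt d$ is an integer and each coordinate $j=(k-1)\sqrt d+k'$ ($k,k'\in[\sqrt d]$) of $[d]$ is identified with the edge between node $k$ of one part and node $k'$ of the other part of the complete bipartite graph with $\sqrt d$ nodes on each side; a perfect matching is thus a subset $\mathcal{S}\subseteq[d]$ with $|\mathcal{S}|=\sqrt d$. $\mathbb{P}_0=N(\mathbf{0},\mathbf{I}_d)$; for $\mathcal{S}\in\mathcal{C}$, $\mathbb{P}_{\mathcal{S}}=(1-\alpha)N(\mathbf{0},\mathbf{I}_d)+\alpha N(\boldsymbol{\theta}_{\mathcal{S}},\mathbf{I}_d)$ (mixture), where $\alpha\in(0,1]$, $(\boldsymbol{\theta}_{\mathcal{S}})_j=\beta^*>0$ for $j\in\mathcal{S}$ and $0$ otherwise. A test $\phi$ is a (measurable) map from the data matrix $\mathbf{X}\in\mathbb{R}^{n\times d}$, whose rows are the $n$ i.i.d. observations, to $\{0,1\}$; its risk is $R(\phi)=\mathbb{P}_0[\phi(\mathbf{X})=1]+\frac{1}{|\mathcal{C}|}\sum_{\mathcal{S}\in\mathcal{C}}\mathbb{P}_{\mathcal{S}}[\phi(\mathbf{X})=0]$,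 where the probabilities refer to the $n$-fold product distributions. Asymptotics: $n,\alpha,\beta^*$ are sequences indexed by $d\to\infty$ with $n\to\infty$; standing assumptions $\alpha n\to\infty$ and $\beta^*=o(1)$. *)

(* Defs.v *)
From HB Require Import structures.
From mathcomp Require Import all_boot all_order all_algebra.
From mathcomp Require Import all_classical all_reals all_analysis.

Set Implicit Arguments.
Unset Strict Implicit.
Unset Printing Implicit Defensive.

Import Order.TTheory GRing.Theory Num.Theory.
Import numFieldNormedType.Exports.

Local Open Scope classical_set_scope.
Local Open Scope ring_scope.

Section product_probability.
Context d (T : measurableType d) (R : realType).

Definition cons_pair n (x : T * n.-tuple T) : n.+1.-tuple T :=
  [tuple of x.1 :: x.2].

Lemma measurable_cons_pair n : measurable_fun setT (@cons_pair n).
Proof. exact: measurable_cons. Qed.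

HB.instance Definition _ n := @isMeasurableFun.Build _ _ _ _
  (@cons_pair n) (@measurable_cons_pair n).

Fixpoint tuple_prob n : ('I_n -> probability T R) -> probability (n.-tuple T) R :=
  match n with
  | 0 => fun _ => \d_[tuple]
  | n'.+1 => fun P =>
      distribution (P ord0 \x tuple_prob (fun i => P (lift ord0 i)))%E
        (@cons_pair n')
  end.

(* A sanity check: by the pi-lambda theorem, this identity characterizes
   [tuple_prob P]. *)
Lemma tuple_probE n (P : 'I_n -> probability T R) (A : 'I_n -> set T) :
  (forall i, measurable (A i)) ->
  tuple_prob P [set x | forall i, A i (tnth x i)] = (\prod_(i < n) P i (A i))%E.
Proof.
elim: n P A => [|n IH] P A mA.
  by rewrite big_ord0 /= diracE mem_set// => -[].
rewrite big_ord_recl /= /distribution /pushforward.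
rewrite (_ : _ @^-1` _ =
    A ord0 `*` [set x | forall i, A (lift ord0 i) (tnth x i)]); last first.
  apply/seteqP; split => [[x t] /= H|[x t] /= [H0 H] i].
    split; first by have := H ord0; rewrite tnth0.
    by move=> i; have := H (lift ord0 i); rewrite tnthS.
  by case: (unliftP ord0 i) => [j ->|->]; rewrite ?tnthS ?tnth0//; exact: H.
have mS : measurable [set x : n.-tuple T | forall i, A (lift ord0 i) (tnth x i)].
  rewrite (_ : [set x | _] =
      \bigcap_(i in [set: 'I_n]) ((@tnth _ T ^~ i) @^-1` A (lift ord0 i))).
    apply: fin_bigcap_measurable => // i _.
    by rewrite -[X in measurable X]setTI; exact: measurable_tnth.
  by apply/seteqP; split => x /= H i; [move=> _; exact: H|exact: H].
rewrite product_measure1E//.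
by congr (_ * _)%E; apply: (IH (fun i => P (lift ord0 i)) (fun i => A (lift ord0 i))).
Qed.

Definition iid n (P : probability T R) : probability (n.-tuple T) R :=
  tuple_prob (fun _ : 'I_n => P).

End product_probability.

Section mixture.
Context d (T : measurableType d) (R : realType).
Variables (a : {i01 R}) (P Q : probability T R).

Definition mixture : set T -> \bar R :=
  measure_add (mscale (1 - a%:num)%:nng P) (mscale (a%:num)%:nng Q).

HB.instance Definition _ := Measure.on mixture.

Let mixture_setT : mixture [set: T] = 1%E.
Proof.
transitivity ((1 - a%:num)%:E * P [set: T] + a%:num%:E * Q [set: T])%E.
  exact: measure_addE.
rewrite !probability_setT !mule1.
by rewrite -EFinD subrK.
Qed.

HB.instance Definition _ :=
  Measure_isProbability.Build _ _ _ mixture mixture_setT.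

End mixture.

Section shifted_mean.
Context (R : realType).
Local Notation Rm := (measurableTypeR R).
Implicit Types (n d : nat) (alpha : {i01 R}) (beta : R).

(* N(theta, I_d) *)
Definition gaussian d (theta : 'I_d -> R) : probability (d.-tuple Rm) R :=
  tuple_prob (fun j => normal_prob (theta j) 1).

Definition theta d beta (S : {set 'I_d}) (j : 'I_d) : R :=
  if j \in S then beta else 0.

Definition P0 d : probability (d.-tuple Rm) R := gaussian (fun=> 0).

Definition PS d alpha beta (S : {set 'I_d}) : probability (d.-tuple Rm) R :=
  mixture alpha (P0 d) (gaussian (theta beta S)).

(* The n x d data matrix is the tuple of its rows; [phi X = true] means that
   the null hypothesis is rejected. *)
Definition test n d := {mfun n.-tuple (d.-tuple Rm) >-> bool}.

Definition risk n d alpha beta (C : {set {set 'I_d}}) (phi : test n d)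
    : \bar R :=
  (iid n (P0 d) [set X | phi X = true] +
   (#|C|%:R^-1)%:E *
     \sum_(S in C) iid n (PS alpha beta S) [set X | phi X = false])%E.

End shifted_mean.

Section perfect_matchings.
Variable s : nat.

(* The nodes of the two parts of K_{s,s} are [inl k] and [inr k']; counting
   from 0, the edge between them is numbered [k * s + k']. *)
Definition incident (j : 'I_(s ^ 2)) (v : 'I_s + 'I_s) : bool :=
  match v with
  | inl k => (j %/ s == k)%N
  | inr k' => (j %% s == k')%N
  end.

Definition perfect_matchings : {set {set 'I_(s ^ 2)}} :=
  [set S : {set 'I_(s ^ 2)} |
    [forall v : 'I_s + 'I_s, #|[set j in S | incident j v]| == 1%N]].

End perfect_matchings.

Lemma card_perfect_matching s S : S \in perfect_matchings s -> #|S| = s.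
Proof.
rewrite inE => /forallP H.
rewrite -[RHS]card_ord -[RHS]sum1_card.
transitivity (\sum_(k < s) #|[set j in S | incident j (inl k)]%SET|)%N; last first.
  by apply: eq_bigr => k _; apply/eqP; exact: H.
case: s S H => [|s] S H.
  by rewrite big_ord0; apply: eq_card0 => -[].
have lt (j : 'I_(s.+1 ^ 2)) : (j %/ s.+1 < s.+1)%N by rewrite ltn_divLR // -[(_ * _)%N]/(s.+1 ^ 2)%N.
rewrite -sum1_card (partition_big (fun j => Ordinal (lt j)) xpredT) //=.
apply: eq_bigr => k _; rewrite -sum1_card; apply: eq_bigl => j.
by rewrite !inE.
Qed.

(* Main.v *)
Require Import Defs.
From HB Require Import structures.
From mathcomp Require Import all_boot all_order all_algebra all_fingroup.
From mathcomp Require Import all_classical all_reals all_analysis.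
From mathcomp Require Import measurable_realfun ring lra.

(* Bayesian second moment method. If L is the likelihood ratio of the average
   alternative against P0, the risk of every test is at least E0[min(1, L)], hence
   at least 1 - e - (E0[L^2] - 1) / (4 e) for every e > 0.

   For S, S' independent uniform perfect matchings, K = |S n S'| is distributed
   as the number of fixed points of a random permutation, and expanding
   z^K = sum_(U fixed) (z - 1)^|U| gives E[z^K] <= exp(z - 1) for z >= 1.

   In regime (i), E0[L^2] = E[(1 + alpha^2 (exp(beta^2 K) - 1))^n], and since
   beta^2 K <= beta^2 s -> 0 this is at most E[exp(2 n alpha^2 beta^2 K)] -> 1.

   In regime (ii) this second moment may diverge. Instead L is written as the
   mixture of the likelihood ratios L_xi given the set xi of the shifted rows, for
   which E0[L_xi^2] = E[exp(beta^2 |xi| K)]. This is close to 1 as soon as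
   beta^2 |xi| is small, which has high probability by Markov's inequality, as
   E|xi| = alpha n. *)

Set Implicit Arguments.
Unset Strict Implicit.
Unset Printing Implicit Defensive.

Import Order.TTheory GRing.Theory Num.Theory.
Import numFieldNormedType.Exports.

Local Open Scope classical_set_scope.
Local Open Scope ring_scope.

(** * Densities *)

Section density.
Context d (T : measurableType d) (R : realType).
Local Open Scope ereal_scope.
Implicit Types (P Q mu : {measure set T -> \bar R}) (f : T -> R).

(* Stated for nonnegative functions rather than for sets, so that densities of
   product measures follow from Tonelli's theorem alone. *)
Definition is_density Q P f : Prop :=
  [/\ measurable_fun setT f, (forall x, 0 <= f x)%R &
      forall g : T -> \bar R, measurable_fun setT g -> (forall x, 0 <= g x) ->
        \int[Q]_x g x = \int[P]_x (g x * (f x)%:E)].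

Lemma is_density_id P : is_density P P (fun=> 1%R).
Proof.
by split => // g mg g0; apply: eq_integral => x _; rewrite mule1.
Qed.

Lemma is_density_measure Q P f A : is_density Q P f -> measurable A ->
  Q A = \int[P]_x (\1_A x * f x)%:E.
Proof.
move=> [mf f0 fE] mA; rewrite -[in LHS](setIT A) -integral_indic//.
by rewrite fE//; exact/measurable_EFinP.
Qed.

Lemma is_density_integral1 (Q : probability T R) P f :
  is_density Q P f -> \int[P]_x (f x)%:E = 1.
Proof.
move=> fP; rewrite -(@probability_setT _ _ _ Q) (is_density_measure fP)//.
by apply: eq_integral => x _; rewrite indicT mul1r.
Qed.

End density.

(** By [fE], [Q] is dominated by [P], and its Radon-Nikodym derivative has the same integral as [f]
    over every measurable set, so the two agree almost everywhere. The change of variables formula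
    for the derivative then passes to [f]. *)
Lemma is_density_set d (T : measurableType d) (R : realType)
    (Q : {finite_measure set T -> \bar R})
    (P : {sigma_finite_measure set T -> \bar R}) (f : T -> R) :
  measurable_fun setT f -> (forall x, 0 <= f x) ->
  (forall A, measurable A -> Q A = \int[P]_(x in A) (f x)%:E)%E ->
  is_density Q P f.
Proof.
move=> mf f0 fE; split => // g mg g0.
have QP : Q `<< P.
  apply/null_content_dominatesP => A mA PA0; rewrite fE//.
  apply: null_set_integral => //.
  exact/measurable_funTS/measurable_EFinP.
rewrite -(Radon_Nikodym_SigmaFinite.change_of_variables QP)//.
have iRN := Radon_Nikodym_SigmaFinite.f_integrable QP.
apply: ge0_ae_eq_integral => //.
- by apply: emeasurable_funM => //; exact: measurable_int iRN.
- by apply: emeasurable_funM => //; exact/measurable_EFinP.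
- by move=> x _; rewrite mule_ge0// Radon_Nikodym_SigmaFinite.f_ge0.
- by move=> x _; rewrite mule_ge0// lee_fin.
apply: filterS (integral_ae_eq measurableT iRN (g := EFin \o f) _ _) => /=.
- by move=> x /(_ I) /= ->.
- exact/measurable_EFinP.
- by move=> E _ mE; rewrite -fE// -Radon_Nikodym_SigmaFinite.f_integral.
Qed.

(** * Integrals and densities on finite products *)

Section tuple_integral.
Context d (T : measurableType d) (R : realType).
Local Open Scope ereal_scope.
Implicit Types n : nat.

Lemma ge0_integral_tuple_prob0 (P : 'I_0 -> probability T R)
    (g : 0.-tuple T -> \bar R) :
  (forall x, 0 <= g x) -> measurable_fun setT g ->
  \int[tuple_prob P]_x g x = g [tuple].
Proof.
move=> g0 mg /=; rewrite integral_dirac//.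
by rewrite diracT mul1e.
Qed.

Lemma ge0_integral_tuple_probS n (P : 'I_n.+1 -> probability T R)
    (g : n.+1.-tuple T -> \bar R) :
  (forall x, 0 <= g x) -> measurable_fun setT g ->
  \int[tuple_prob P]_x g x =
  \int[P ord0]_x \int[tuple_prob (fun i => P (lift ord0 i))]_t
     g (cons_pair (x, t)).
Proof.
move=> g0 mg /=.
rewrite ge0_integral_distribution//.
rewrite fubini_tonelli1//; last by move=> x; exact: g0.
by apply: measurableT_comp => //; exact: measurable_cons_pair.
Qed.

Lemma measurable_prod_tnth n (f : 'I_n -> T -> R) :
  (forall i, measurable_fun setT (f i)) ->
  measurable_fun setT (fun x : n.-tuple T => \prod_(i < n) f i (tnth x i))%R.
Proof.
move=> mf; apply: measurable_prod => i _.
by apply: measurableT_comp => //; exact: measurable_tnth.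
Qed.

Lemma prod_cons_pair n (f : 'I_n.+1 -> T -> R) x t :
  (\prod_(i < n.+1) f i (tnth (cons_pair (x, t)) i) =
   f ord0 x * \prod_(i < n) f (lift ord0 i) (tnth t i))%R.
Proof.
rewrite big_ord_recl tnth0; congr (_ * _)%R.
by apply: eq_bigr => i _; rewrite tnthS.
Qed.

Lemma ge0_integral_prod_tnth n (P : 'I_n -> probability T R)
    (f : 'I_n -> T -> R) :
  (forall i, measurable_fun setT (f i)) -> (forall i x, 0 <= f i x)%R ->
  \int[tuple_prob P]_x (\prod_(i < n) f i (tnth x i))%:E =
  \prod_(i < n) \int[P i]_x (f i x)%:E.
Proof.
elim: n P f => [|n IH] P f mf f0.
  rewrite ge0_integral_tuple_prob0 ?big_ord0//.
    by move=> x; rewrite lee_fin big_ord0.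
  by apply/measurable_EFinP; exact: measurable_prod_tnth.
rewrite ge0_integral_tuple_probS; last 2 first.
- by move=> x; rewrite lee_fin prodr_ge0.
- by apply/measurable_EFinP; exact: measurable_prod_tnth.
rewrite big_ord_recl -IH//.
rewrite -ge0_integralZr//; last 3 first.
- exact/measurable_EFinP.
- by move=> x _; rewrite lee_fin.
- by apply: integral_ge0 => t _; rewrite lee_fin prodr_ge0.
apply: eq_integral => x _; rewrite -ge0_integralZl//; last 3 first.
- apply/measurable_EFinP.
  exact: (measurable_prod_tnth (f := fun i => f (lift ord0 i))).
- by move=> t _; rewrite lee_fin prodr_ge0.
- by rewrite lee_fin.
by apply: eq_integral => t _; rewrite prod_cons_pair EFinM.
Qed.

Lemma ge0_integral_prod_tnthM n (P : 'I_n -> probability T R)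
    (f g : 'I_n -> T -> R) :
  (forall i, measurable_fun setT (f i)) -> (forall i x, 0 <= f i x)%R ->
  (forall i, measurable_fun setT (g i)) -> (forall i x, 0 <= g i x)%R ->
  \int[tuple_prob P]_x
    ((\prod_(i < n) f i (tnth x i)) * (\prod_(i < n) g i (tnth x i)))%:E =
  \prod_(i < n) \int[P i]_x (f i x * g i x)%:E.
Proof.
move=> mf f0 mg g0.
rewrite -(ge0_integral_prod_tnth P (f := fun i x => f i x * g i x)%R).
- by apply: eq_integral => x _; rewrite big_split.
- by move=> i; exact: measurable_funM.
- by move=> i x; rewrite mulr_ge0.
Qed.

(** Induction on [n], splitting off the first coordinate by Tonelli. *)
Lemma is_density_tuple_prob n (Q P : 'I_n -> probability T R)
    (f : 'I_n -> T -> R) :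
  (forall i, is_density (Q i) (P i) (f i)) ->
  is_density (tuple_prob Q) (tuple_prob P)
    (fun x => \prod_(i < n) f i (tnth x i))%R.
Proof.
move=> fP.
have mf i : measurable_fun setT (f i) by case: (fP i).
have f0 i x : (0 <= f i x)%R by case: (fP i).
split; [exact: measurable_prod_tnth|by move=> x; exact: prodr_ge0|].
elim: n Q P f fP mf f0 => [|n IH] Q P f fP mf f0 g mg g0.
  rewrite !ge0_integral_tuple_prob0//.
  - by rewrite big_ord0 mule1.
  - by move=> x; rewrite big_ord0 mule1.
  - by under eq_fun do rewrite big_ord0 mule1.
have mF := measurable_prod_tnth mf.
rewrite !ge0_integral_tuple_probS//; last 2 first.
- by move=> x; rewrite mule_ge0// lee_fin prodr_ge0.
- by apply: emeasurable_funM => //; exact/measurable_EFinP.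
(* The density of the first coordinate is applied to the inner integral over the remaining ones,
   viewed as a nonnegative function of the first. *)
have [_ _ ->] := fP ord0; last 2 first.
- apply: (measurable_fun_fubini_tonelli_F (fun z => g (cons_pair z))) => //.
  by apply: measurableT_comp => //; exact: measurable_cons_pair.
- by move=> x; exact: integral_ge0.
apply: eq_integral => x _.
have mgx : measurable_fun setT (fun t => g (cons_pair (x, t))).
  exact: (measurableT_comp mg
    (measurableT_comp (@measurable_cons_pair _ T n) (pair1_measurable x))).
rewrite (IH _ (fun i => P (lift ord0 i)) (fun i => f (lift ord0 i)))//.
rewrite muleC -ge0_integralZl//; last 3 first.
- apply: emeasurable_funM => //; apply/measurable_EFinP.
  exact: (measurable_prod_tnth (f := fun i => f (lift ord0 i))).
- by move=> t _; rewrite mule_ge0// lee_fin prodr_ge0.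
- by rewrite lee_fin.
by apply: eq_integral => t _; rewrite prod_cons_pair EFinM muleCA.
Qed.

End tuple_integral.

Lemma is_density_mixture d (T : measurableType d) (R : realType) (a : {i01 R})
    (P Q : probability T R) (f : T -> R) :
  is_density Q P f ->
  is_density (mixture a P Q) P (fun x => 1 - a%:num + a%:num * f x).
Proof.
move=> [mf f0 fE]; have a1 : 0 <= 1 - a%:num by rewrite subr_ge0.
split.
- by apply: measurable_funD => //; exact: measurable_funM.
- by move=> x; rewrite addr_ge0// mulr_ge0.
move=> g mg g0; rewrite /mixture ge0_integral_measure_add//.
rewrite !ge0_integral_mscale//= fE//.
rewrite -!ge0_integralZl//; last 2 first.
- by apply: emeasurable_funM => //; exact/measurable_EFinP.
- by move=> x _; rewrite mule_ge0// lee_fin.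
rewrite -ge0_integralD//.
- apply: eq_integral => x _.
  rewrite [in RHS]EFinD ge0_muleDr ?lee_fin ?mulr_ge0// muleC; congr +%E.
  by rewrite EFinM muleCA.
- by move=> x _; rewrite mule_ge0// lee_fin.
- exact: emeasurable_funM.
- by move=> x _; rewrite !mule_ge0// lee_fin.
- apply: emeasurable_funM => //; apply: emeasurable_funM => //.
  exact/measurable_EFinP.
Qed.

(** * Overlaps of perfect matchings *)

Section matchings.
Local Open Scope set_scope.

Lemma sum_card_set (V : nmodType) (T : finType) (F : nat -> V) :
  \sum_(U : {set T}) F #|U| = \sum_(k < #|T|.+1) F k *+ 'C(#|T|, k).
Proof.
rewrite (partition_big (fun U : {set T} => inord #|U| : 'I_#|T|.+1) xpredT)//=.
apply: eq_bigr => k _; rewrite -card_draws -sumr_const.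
have cardU (U : {set T}) : ((inord #|U| : 'I_#|T|.+1) == k) = (#|U| == k).
  by rewrite -val_eqE /= inordK// ltnS max_card.
by apply: eq_big => U; rewrite cardU ?inE// => /eqP ->.
Qed.

(** For [x >= 0] the partial sums of the exponential series increase to their limit. *)
Lemma sum_exp_coeff_le (R : realType) (x : R) n :
  0 <= x -> \sum_(k < n) x ^+ k / k`!%:R <= expR x.
Proof.
move=> x0; rewrite /expR -(big_mkord xpredT (fun k => x ^+ k / k`!%:R)).
apply: nondecreasing_cvgn_le; last exact: is_cvg_series_exp_coeff.
apply/nondecreasing_seqP => m; rewrite /series/= big_nat_recr//= lerDl.
exact: exp_coeff_ge0.
Qed.

(** With u = z - 1, exchanging the sums over [p] and over sets U of fixed points leaves u^|U| (s -
    |U|)! for each U. Since C(s,k) (s - k)! = s! / k!, the total is s! times a partial sum of the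
    series of exp(u). *)
Lemma sum_perm_fix_le (R : realType) (s : nat) (z : R) : 1 <= z ->
  \sum_(p : 'S_s) z ^+ #|[set k | p k == k]| <= s`!%:R * expR (z - 1).
Proof.
move=> z1; have u0 : 0 <= z - 1 by rewrite subr_ge0.
set u := z - 1 in u0 *.
have powE (p : 'S_s) : z ^+ #|[set k | p k == k]| =
    \sum_(U : {set 'I_s}) u ^+ #|U| * (p \in perm_on (~: U))%:R.
  rewrite -prodr_const big_mkcond/=.
  transitivity (\prod_(k < s) ((if p k == k then u else 0) + 1)).
    apply: eq_bigr => k _; rewrite inE; case: ifP => _; last by rewrite add0r.
    by rewrite subrK.
  rewrite bigA_distr; apply: eq_bigr => U _.
  (* If [p] fixes [U] pointwise, every factor indexed by [U] is [u]; otherwise some [k] in [U] is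
     moved and its factor 0 kills the product. *)
  have [pU|/subsetPn[k pk]] := boolP (p \in perm_on (~: U)).
    rewrite mulr1 -prodr_const [RHS]big_mkcond/=; apply: eq_bigr => k _.
    case: ifPn => // kU; rewrite (out_perm pU) ?eqxx// inE kU//.
  rewrite inE negbK => kU; rewrite mulr0 (bigD1 k)//= kU.
  by move: pk; rewrite unfold_in => /negbTE ->; rewrite mul0r.
under eq_bigr do rewrite powE.
rewrite exchange_big/=.
(* The permutations fixing [U] pointwise are those supported on its complement. *)
rewrite (eq_bigr (fun U : {set 'I_s} => u ^+ #|U| * ((s - #|U|)`!)%:R)); last first.
  move=> U _; rewrite -mulr_sumr; congr (_ * _).
  transitivity (#|perm_on (~: U)|%:R : R).
    rewrite -sum1_card natr_sum [RHS]big_mkcond/=.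
    by apply: eq_bigr => p _; case: ifP.
  by rewrite card_perm cardsCs finset.setCK card_ord.
rewrite (sum_card_set _ (fun k => u ^+ k * ((s - k)`!)%:R)).
apply: le_trans (ler_wpM2l _ (sum_exp_coeff_le s.+1 u0)) => //.
rewrite card_ord mulr_sumr; apply: ler_sum => k _.
rewrite -mulr_natr -(@bin_fact s k) -1?ltnS// !natrM le_eqVlt.
by apply/orP; left; apply/eqP; field; rewrite pnatr_eq0 -lt0n fact_gt0.
Qed.

(** Substituting [p * q] for [p] turns the points of agreement with [q] into fixed points of [p]. *)
Lemma sum_perm_eq_le (R : realType) (s : nat) (z : R) (q : 'S_s) : 1 <= z ->
  \sum_(p : 'S_s) z ^+ #|[set k | p k == q k]| <= s`!%:R * expR (z - 1).
Proof.
move=> z1; rewrite (reindex_inj (mulIg q)); apply: le_trans (sum_perm_fix_le s z1).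
apply: ler_sum => p _; rewrite le_eqVlt; apply/orP; left; apply/eqP.
congr (_ ^+ #|pred_of_set _|).
by apply/setP => k; rewrite !inE permM (inj_eq perm_inj).
Qed.

Variable s : nat.

Lemma edge_subproof (k k' : 'I_s) : (k * s + k' < s ^ 2)%N.
Proof.
rewrite -mulnn; apply: (@leq_trans (k.+1 * s)).
  by rewrite mulSn addnC ltn_add2r.
by rewrite leq_mul2r ltn_ord orbT.
Qed.

Definition edge (k k' : 'I_s) : 'I_(s ^ 2) := Ordinal (edge_subproof k k').

Lemma incident_edgel k k' i : incident (edge k k') (inl i) = (k == i).
Proof.
have s0 : (0 < s)%N by exact: leq_ltn_trans (ltn_ord k).
by rewrite /= divnMDl// divn_small// addn0.
Qed.

Lemma incident_edger k k' i : incident (edge k k') (inr i) = (k' == i).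
Proof. by rewrite /= modnMDl modn_small. Qed.

Lemma edgeP (j : 'I_(s ^ 2)) : exists k k', j = edge k k'.
Proof.
have s0 : (0 < s)%N by case: s j => // -[].
have jk : (j %/ s < s)%N by rewrite ltn_divLR// mulnn.
have jk' : (j %% s < s)%N by rewrite ltn_mod.
exists (Ordinal jk), (Ordinal jk'); apply: val_inj => /=.
exact: divn_eq.
Qed.

Lemma edge_inj k k' i i' : edge k k' = edge i i' -> k = i /\ k' = i'.
Proof.
move=> e; split; apply/eqP.
  by rewrite -(incident_edgel k k') e incident_edgel.
by rewrite -(incident_edger k k') e incident_edger.
Qed.

Definition matching (p : 'S_s) : {set 'I_(s ^ 2)} :=
  [set edge k (p k) | k : 'I_s].

Lemma mem_matching p k k' : (edge k k' \in matching p) = (p k == k').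
Proof.
apply/imsetP/eqP => [[i _ /edge_inj[-> ->]]//|<-]; by exists k.
Qed.

Lemma matching_perfect p : matching p \in perfect_matchings s.
Proof.
rewrite inE; apply/forallP => -[i|i]; apply/cards1P.
- exists (edge i (p i)); apply/setP => j; have [k [k' ->]] := edgeP j.
  rewrite inE mem_matching incident_edgel inE.
  apply/andP/eqP => [[/eqP <- /eqP ->]//|/edge_inj[-> ->]]; by rewrite !eqxx.
- exists (edge (p^-1%g i) i); apply/setP => j; have [k [k' ->]] := edgeP j.
  rewrite inE mem_matching incident_edger inE.
  apply/andP/eqP => [[/eqP <- /eqP <-]|/edge_inj[-> ->]].
    by rewrite permK.
  by rewrite permKV !eqxx.
Qed.

Lemma matching_inj : injective matching.
Proof.
move=> p q pq; apply/permP => k; apply/esym/eqP.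
by rewrite -mem_matching -pq mem_matching.
Qed.

(** Degree one at the left nodes makes [S] the graph of a function [f]; degree one at the right
    nodes makes [f] injective, hence a permutation. *)
Lemma perfect_matchingE : perfect_matchings s = [set matching p | p : 'S_s].
Proof.
apply/setP => S; apply/idP/imsetP => [|[p _ ->]]; last exact: matching_perfect.
rewrite inE => /forallP H.
have row k : exists k', [set j in S | incident j (inl k)] = [set edge k k'].
  have /cards1P[j Sj] := H (inl k); have [i [k' jE]] := edgeP j.
  exists k'; rewrite Sj jE; have : j \in [set j] by rewrite inE.
  by rewrite -Sj inE jE incident_edgel => /andP[_ /eqP ->].
have {row}[f fS] := choice row.
have memS k k' : (edge k k' \in S) = (f k == k').
  have := fS k => /setP /(_ (edge k k')); rewrite inE incident_edgel eqxx andbT.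
  by move=> ->; rewrite inE; apply/eqP/eqP => [/edge_inj[]//|->].
have f_inj : injective f.
  move=> k i fki; have /cards1P[j Sj] := H (inr (f k)).
  have : edge k (f k) \in [set j] by rewrite -Sj inE memS incident_edger !eqxx.
  have : edge i (f k) \in [set j].
    by rewrite -Sj inE memS incident_edger fki !eqxx.
  by rewrite !inE => /eqP <- /eqP /edge_inj[].
exists (perm f_inj) => //; apply/setP => j; have [k [k' ->]] := edgeP j.
by rewrite mem_matching memS permE.
Qed.

Lemma card_matchingI p q : #|matching p :&: matching q| = #|[set k | p k == q k]|.
Proof.
rewrite -(card_imset (f := fun k => edge k (q k))); last first.
  by move=> k i /edge_inj[].
congr #|pred_of_set _|; apply/setP => j; have [k [k' ->]] := edgeP j.
rewrite inE !mem_matching; apply/andP/imsetP => [[/eqP pk /eqP qk]|[i]].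
  by exists k; rewrite ?inE ?pk qk.
by rewrite inE => /eqP pq /edge_inj[-> ->]; rewrite pq.
Qed.

Lemma card_perfect_matchings : #|perfect_matchings s| = s`!.
Proof. by rewrite perfect_matchingE card_imset ?card_Sn//; exact: matching_inj. Qed.

(** This is E[z^K] <= exp(z - 1), cleared of denominators, for the overlap K of two independent
    uniform matchings. The bound already holds when one of the two is fixed. *)
Lemma sum_perfect_matchingsI_le (R : realType) (z : R) : 1 <= z ->
  \sum_(S in perfect_matchings s) \sum_(S' in perfect_matchings s)
    z ^+ #|S :&: S'| <= #|perfect_matchings s|%:R ^+ 2 * expR (z - 1).
Proof.
move=> z1; rewrite card_perfect_matchings perfect_matchingE.
rewrite big_imset /=; last by move=> p q _ _; exact: matching_inj.
under eq_bigr => p _.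
  rewrite big_imset /=; last by move=> ? ? _ _; exact: matching_inj.
  under eq_bigr do rewrite card_matchingI.
  over.
rewrite exchange_big/=.
apply: (@le_trans _ _ (\sum_(q in 'S_s) s`!%:R * expR (z - 1))).
  apply: ler_sum => q _; apply: le_trans (sum_perm_eq_le q z1).
  by rewrite le_eqVlt; apply/orP; left; apply/eqP/eq_bigl => p; rewrite inE.
by rewrite sumr_const card_Sn le_eqVlt; apply/orP; left; apply/eqP; ring.
Qed.

End matchings.

(** * Gaussian likelihood ratios *)

Section likelihood.
Context (R : realType).
Local Notation Rm := (measurableTypeR R).

(** The likelihood ratio of N(b, 1) against N(0, 1). *)
Definition normal_lr (b x : R) : R := expR (b * x - b ^+ 2 / 2).

Lemma measurable_normal_lr b : measurable_fun [set: Rm] (normal_lr b).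
Proof.
by apply: measurableT_comp => //; apply: measurable_funB => //;
  exact: measurable_funM.
Qed.

Lemma normal_pdf_lr (b x : R) :
  normal_pdf b 1 x = normal_pdf 0 1 x * normal_lr b x.
Proof.
rewrite !normal_pdfE ?oner_eq0// /normal_fun -mulrA -expRD; congr (_ * expR _).
by field.
Qed.

Lemma is_density_normal_pdf m :
  is_density (normal_prob m 1 : probability Rm R) (@lebesgue_measure R)
    (normal_pdf m 1).
Proof.
apply: is_density_set => //; first exact: measurable_normal_pdf.
exact: normal_pdf_ge0.
Qed.

Lemma is_density_normal_lr b :
  is_density (normal_prob b 1 : probability Rm R)
    (normal_prob 0 1 : probability Rm R) (normal_lr b).
Proof.
have [_ _ E0] := is_density_normal_pdf 0.
have [_ _ Eb] := is_density_normal_pdf b.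
split; [exact: measurable_normal_lr|by move=> x; exact: expR_ge0|].
move=> g mg g0; rewrite Eb// E0//.
- apply: eq_integral => x _.
  by rewrite normal_pdf_lr mulrC EFinM muleA.
- apply: emeasurable_funM => //; apply/measurable_EFinP.
  exact: measurable_normal_lr.
- by move=> x; rewrite mule_ge0// lee_fin expR_ge0.
Qed.

(** Completing the square, the product of the two ratios is exp(ab) times the likelihood ratio of
    mean [a + b], which integrates to 1. *)
Lemma integral_normal_lrM a b :
  (\int[normal_prob 0 1]_x (normal_lr a x * normal_lr b x)%:E =
   (expR (a * b))%:E)%E.
Proof.
rewrite (eq_integral (fun x : Rm => (expR (a * b))%:E * (normal_lr (a + b) x)%:E)%E).
  rewrite ge0_integralZl//.
  - by rewrite (is_density_integral1 (is_density_normal_lr _)) mule1.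
  - by apply/measurable_EFinP; exact: measurable_normal_lr.
  - by move=> x _; rewrite lee_fin expR_ge0.
move=> x _; rewrite -EFinM -!expRD; congr (expR _)%:E.
by field.
Qed.

Variables (d : nat).
Implicit Types (S : {set 'I_d}) (x : d.-tuple Rm) (beta : R).

Definition gauss_lr beta S x : R :=
  \prod_(j < d) normal_lr (theta beta S j) (tnth x j).

Lemma is_density_gauss_lr beta S :
  is_density (gaussian (theta beta S)) (P0 R d) (gauss_lr beta S).
Proof.
exact: (@is_density_tuple_prob _ Rm R d
  (fun j => normal_prob (theta beta S j) 1) (fun=> normal_prob 0 1)
  (fun j => normal_lr (theta beta S j)) (fun j => is_density_normal_lr _)).
Qed.

(** The integral factors over the coordinates; a coordinate contributes exp(beta^2) if it lies in
    both sets, and 1 otherwise. *)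
Lemma integral_gauss_lrM beta S S' :
  (\int[P0 R d]_x (gauss_lr beta S x * gauss_lr beta S' x)%:E =
   (expR (beta ^+ 2) ^+ #|S :&: S'|)%:E)%E.
Proof.
have mlr S'' j : measurable_fun setT (normal_lr (theta beta S'' j)).
  exact: measurable_normal_lr.
have lr0 S'' j (y : Rm) : 0 <= normal_lr (theta beta S'' j) y by exact: expR_ge0.
have -> := @ge0_integral_prod_tnthM _ Rm R d (fun=> normal_prob 0 1) _ _
  (mlr S) (lr0 S) (mlr S') (lr0 S').
rewrite -prodr_const [in RHS]big_mkcond/= -prodEFin; apply: eq_bigr => j _.
rewrite integral_normal_lrM /theta inE expr2.
by case: (j \in S); case: (j \in S'); rewrite /= ?mulr0 ?mul0r ?expR0.
Qed.

End likelihood.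

(** * Likelihood ratios of the mixtures *)

Section mixture_likelihood.
Context (R : realType).
Variables (d : nat).
Implicit Types (S : {set 'I_d}) (beta : R).

Definition mix_lr (alpha : {i01 R}) beta S x : R :=
  1 - alpha%:num + alpha%:num * gauss_lr beta S x.

Lemma is_density_mix_lr alpha beta S :
  is_density (PS alpha beta S) (P0 R d) (mix_lr alpha beta S).
Proof. exact/is_density_mixture/is_density_gauss_lr. Qed.

Lemma integral_mix_lrM alpha beta S S' :
  (\int[P0 R d]_x (mix_lr alpha beta S x * mix_lr alpha beta S' x)%:E =
   (1 + alpha%:num ^+ 2 * (expR (beta ^+ 2) ^+ #|S :&: S'| - 1))%:E)%E.
Proof.
have DS := is_density_gauss_lr beta S; have [mS S0 _] := DS.
have DS' := is_density_mix_lr alpha beta S'; have [mS' S'0 _] := DS'.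
have [mG G0 _] := is_density_gauss_lr beta S'.
have a1 : 0 <= 1 - alpha%:num by rewrite subr_ge0.
have a0 : 0 <= alpha%:num by [].
set a := alpha%:num in a0 a1 *.
have aa0 : 0 <= a * (1 - a) by rewrite mulr_ge0.
(* The product is split into the nonnegative terms [u], [v] and [w], whose integrals add up with no
   integrability condition. *)
pose u (x : d.-tuple (measurableTypeR R)) := ((1 - a)%:E * (mix_lr alpha beta S' x)%:E)%E.
pose v x := ((a * (1 - a))%:E * (gauss_lr beta S x)%:E)%E.
pose w x := ((a ^+ 2)%:E * (gauss_lr beta S x * gauss_lr beta S' x)%:E)%E.
have mu_ : measurable_fun setT u by apply: measurable_funeM; exact/measurable_EFinP.
have mv_ : measurable_fun setT v by apply: measurable_funeM; exact/measurable_EFinP.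
have mgg : measurable_fun setT (fun x => (gauss_lr beta S x * gauss_lr beta S' x)%:E).
  by apply/measurable_EFinP; exact: measurable_funM.
have mw_ : measurable_fun setT w by exact: measurable_funeM.
have u0 x : (0 <= u x)%E by rewrite mule_ge0// lee_fin.
have v0 x : (0 <= v x)%E by rewrite mule_ge0// lee_fin.
have w0 x : (0 <= w x)%E by rewrite mule_ge0// lee_fin ?sqr_ge0// mulr_ge0.
transitivity (\int[P0 R d]_x (u x + (v x + w x)))%E.
  apply: eq_integral => x _; rewrite /u /v /w -!EFinM -!EFinD /mix_lr -/a.
  by congr EFin; ring.
rewrite ge0_integralD//; last 2 first.
- by move=> x _; rewrite adde_ge0.
- exact: emeasurable_funD.
rewrite ge0_integralD//.
rewrite !ge0_integralZl//; last 6 first.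
- by move=> x _; rewrite lee_fin mulr_ge0.
- by rewrite lee_fin sqr_ge0.
- exact/measurable_EFinP.
- by move=> x _; rewrite lee_fin.
- exact/measurable_EFinP.
- by move=> x _; rewrite lee_fin.
rewrite (is_density_integral1 DS') (is_density_integral1 DS) integral_gauss_lrM.
by rewrite !mule1 -!EFinM -!EFinD; congr EFin; ring.
Qed.

End mixture_likelihood.

(** * Lower bounds on the risk *)

Section testing.
Context d (T : measurableType d) (R : realType).
Implicit Types (A : set T) (f : T -> R).

(* Integrating it against [P] gives the sum of the two error probabilities, under
   [P] and under the measure of density [f], of the test rejecting on [A]. *)
Definition error_density A f (x : T) : R := \1_A x + \1_(~` A) x * f x.

Lemma measurable_error_density A f : measurable A -> measurable_fun setT f ->
  measurable_fun setT (error_density A f).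
Proof.
move=> mA mf; apply: measurable_funD; first exact: measurable_indic.
by apply: measurable_funM => //; apply: measurable_indic; exact: measurableC.
Qed.

Lemma error_density_ge0 A f x : (forall y, 0 <= f y) -> 0 <= error_density A f x.
Proof. by move=> f0; rewrite addr_ge0// mulr_ge0. Qed.

(* Up to the factor [4 * e], this is [min(1, f) >= 1 - e - (f - 1)^2 / (4 e)]. *)
Lemma error_density_lb A f x e :
  4 * e + 2 * f x <= 4 * e * error_density A f x + (4 * e ^+ 2 + 1 + f x * f x).
Proof.
rewrite /error_density !indicE in_setC; have [xA|xA] /= := boolP (x \in A).
  have := sqr_ge0 (f x - 1); have := sqr_ge0 e; rewrite !expr2; lra.
by have := sqr_ge0 (2 * e - (1 - f x)); rewrite !expr2; lra.
Qed.

(** Integrating [error_density_lb] gives 4e + 2 <= 4e t + 4e^2 + 1 + E[f^2], where t is the integral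
    to be bounded, and E[f^2] <= 1 + eta. Both sides of the pointwise bound are kept nonnegative so
    that it can be integrated term by term. *)
Lemma testing_lower_bound (P : probability T R) A f (e eta : R) :
  measurable A -> measurable_fun setT f -> (forall x, 0 <= f x) ->
  (\int[P]_x (f x)%:E = 1)%E ->
  (\int[P]_x (f x * f x)%:E <= (1 + eta)%:E)%E -> 0 < e ->
  ((1 - e - eta / (4 * e))%:E <= \int[P]_x (error_density A f x)%:E)%E.
Proof.
move=> mA mf f0 f1 f2 e0.
have mE := measurable_error_density mA mf.
have E0 x : 0 <= error_density A f x by exact: error_density_ge0.
have e4 : 0 <= 4 * e by rewrite mulr_ge0// ltW.
have mff : measurable_fun setT (fun x => f x * f x) by exact: measurable_funM.
have : (\int[P]_x ((4 * e)%:E + 2%:E * (f x)%:E) <=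
    \int[P]_x ((4 * e)%:E * (error_density A f x)%:E +
      ((4 * e ^+ 2 + 1)%:E + (f x * f x)%:E)))%E.
  apply: ge0_le_integral => //.
  - by move=> x _; rewrite adde_ge0 ?mule_ge0 ?lee_fin.
  - by apply: emeasurable_funD => //; apply: measurable_funeM; exact/measurable_EFinP.
  - apply: emeasurable_funD; first by apply: measurable_funeM; exact/measurable_EFinP.
    by apply: emeasurable_funD => //; exact/measurable_EFinP.
  - move=> x _; rewrite -!EFinM -!EFinD lee_fin.
    exact: error_density_lb.
have e42 : 0 <= 4 * e ^+ 2 + 1 by rewrite addr_ge0// mulr_ge0// sqr_ge0.
rewrite !ge0_integralD//; last 8 first.
- by move=> x _; rewrite lee_fin mulr_ge0.
- exact/measurable_EFinP.
- by move=> x _; rewrite mule_ge0 ?lee_fin.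
- by apply: measurable_funeM; exact/measurable_EFinP.
- by move=> x _; rewrite adde_ge0 ?lee_fin ?mulr_ge0.
- by apply: emeasurable_funD => //; exact/measurable_EFinP.
- by move=> x _; rewrite mule_ge0 ?lee_fin.
- by apply: measurable_funeM; exact/measurable_EFinP.
rewrite !ge0_integralZl//; last 4 first.
- exact/measurable_EFinP.
- by move=> x _; rewrite lee_fin.
- exact/measurable_EFinP.
- by move=> x _; rewrite lee_fin.
have cstE k : (\int[P]__ k%:E = k%:E)%E.
  by rewrite integral_cst// -[RHS]mule1; congr *%E; exact: probability_setT.
rewrite !cstE f1 mule1.
have : (0 <= \int[P]_x (error_density A f x)%:E)%E.
  by apply: integral_ge0 => x _; rewrite lee_fin.
have : (0 <= \int[P]_x (f x * f x)%:E)%E.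
  by apply: integral_ge0 => x _; rewrite lee_fin mulr_ge0.
(* The second moment [q] is finite by [f2], and the claim is trivial if the error integral is
   infinite, so what remains is an inequality between reals. *)
move: f2; case: (\int[P]_x (f x * f x)%:E)%E => [q| |]//.
case: (\int[P]_x (error_density A f x)%:E)%E => [t| |]//; last by move=> *; rewrite leey.
rewrite -!EFinM -!EFinD !lee_fin => qeta _ _ tq.
have : 4 * e * (1 - e - t) <= eta by rewrite expr2 in tq; lra.
rewrite mulrC -ler_pdivlMr ?mulr_gt0//; lra.
Qed.

Lemma measurable_sum_in (X : finType) (C : {set X}) (f : X -> T -> R) :
  (forall S, measurable_fun setT (f S)) ->
  measurable_fun setT (fun x => \sum_(S in C) f S x).
Proof.
move=> mf; under eq_fun do rewrite -big_enum.
exact: measurable_sum.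
Qed.

(** The average of the second-kind errors is linear in the densities, so the alternatives may be
    replaced by the single averaged likelihood ratio. *)
Lemma is_density_error (P : probability T R) (X : finType) (C : {set X})
    (Q : X -> probability T R) (f : X -> T -> R) A :
  measurable A -> (forall S, is_density (Q S) P (f S)) ->
  (P A + (#|C|%:R^-1)%:E * \sum_(S in C) Q S (~` A) =
   \int[P]_x (error_density A (fun x => #|C|%:R^-1 * \sum_(S in C) f S x) x)%:E)%E.
Proof.
move=> mA fQ.
have mf S : measurable_fun setT (f S) by case: (fQ S).
have f0 S x : 0 <= f S x by case: (fQ S).
have mAc := measurableC mA.
have mAf S : measurable_fun setT (fun x => (\1_(~` A) x * f S x)%:E).
  by apply/measurable_EFinP; exact: measurable_funM.
set L := fun x : T => #|C|%:R^-1 * _.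
have mL : measurable_fun setT L.
  by apply: measurable_funM => //; exact: measurable_sum_in.
have L0 x : 0 <= L x by rewrite mulr_ge0// sumr_ge0.
transitivity (\int[P]_x ((\1_A x)%:E + (\1_(~` A) x * L x)%:E))%E; last first.
  by apply: eq_integral => x _; rewrite -EFinD.
rewrite ge0_integralD//; last 3 first.
- exact/measurable_EFinP.
- by move=> x _; rewrite lee_fin mulr_ge0.
- by apply/measurable_EFinP; exact: measurable_funM.
rewrite integral_indic// setIT; congr +%E.
rewrite -big_enum/=.
rewrite (eq_bigr (fun S => \int[P]_x (\1_(~` A) x * f S x)%:E)%E); last first.
  by move=> S _; exact: is_density_measure.
rewrite -ge0_integral_sum//; last by move=> S x _; rewrite lee_fin mulr_ge0.
rewrite -ge0_integralZl//; last 2 first.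
- exact: emeasurable_sum.
- by move=> x _; apply: sume_ge0 => // S _; rewrite lee_fin mulr_ge0.
apply: eq_integral => x _.
by rewrite sumEFin -EFinM -mulr_sumr big_enum/= mulrCA.
Qed.

Lemma integral_avg_sqr (P : probability T R) (X : finType) (C : {set X})
    (f : X -> T -> R) (c : X -> X -> R) :
  (forall S, measurable_fun setT (f S)) -> (forall S x, 0 <= f S x) ->
  (forall S S', \int[P]_x (f S x * f S' x)%:E = (c S S')%:E)%E ->
  let g x := #|C|%:R^-1 * \sum_(S in C) f S x in
  (\int[P]_x (g x * g x)%:E =
    (#|C|%:R ^- 2 * \sum_(S in C) \sum_(S' in C) c S S')%:E)%E.
Proof.
move=> mf f0 fc g.
have mff S S' : measurable_fun setT (fun x => (f S x * f S' x)%:E).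
  by apply/measurable_EFinP; exact: measurable_funM.
transitivity (\int[P]_x ((#|C|%:R ^- 2)%:E *
    \sum_(S <- enum C) \sum_(S' <- enum C) (f S x * f S' x)%:E))%E.
  apply: eq_integral => x _; rewrite /g.
  under [in RHS]eq_bigr do rewrite sumEFin.
  rewrite sumEFin -EFinM; congr EFin.
  rewrite !big_enum/= mulrACA -expr2 exprVn; congr (_ * _).
  rewrite mulr_suml; apply: eq_bigr => S _.
  by rewrite mulr_sumr big_enum.
rewrite ge0_integralZl//; last 2 first.
- by apply: emeasurable_sum => S; exact: emeasurable_sum.
- move=> x _; apply: sume_ge0 => // S _; apply: sume_ge0 => // S' _.
  by rewrite lee_fin mulr_ge0.
rewrite EFinM; congr (_ * _)%E.
rewrite ge0_integral_sum//; last 2 first.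
- by move=> S; exact: emeasurable_sum.
- by move=> S x _; apply: sume_ge0 => // S' _; rewrite lee_fin mulr_ge0.
rewrite -big_enum/= -sumEFin.
apply: eq_bigr => S _.
rewrite ge0_integral_sum//; last by move=> S' x _; rewrite lee_fin mulr_ge0.
by rewrite -big_enum/= -sumEFin; apply: eq_bigr => S' _; exact: fc.
Qed.

Lemma integral_avg (P : probability T R) (X : finType) (C : {set X})
    (f : X -> T -> R) :
  (forall S, measurable_fun setT (f S)) -> (forall S x, 0 <= f S x) ->
  (forall S, \int[P]_x (f S x)%:E = 1)%E -> (0 < #|C|)%N ->
  (\int[P]_x (#|C|%:R^-1 * \sum_(S in C) f S x)%:E = 1)%E.
Proof.
move=> mf f0 f1 C0.
have mEf S : measurable_fun setT (EFin \o f S) by exact/measurable_EFinP.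
transitivity (\int[P]_x ((#|C|%:R^-1)%:E * \sum_(S <- enum C) (f S x)%:E))%E.
  by apply: eq_integral => x _; rewrite sumEFin -EFinM big_enum.
rewrite ge0_integralZl//; last 2 first.
- exact: emeasurable_sum.
- by move=> x _; apply: sume_ge0 => // S _; rewrite lee_fin.
rewrite ge0_integral_sum//; last by move=> S x _; rewrite lee_fin.
under eq_bigr do rewrite f1.
rewrite big_enum/= sumEFin sumr_const -EFinM mulVf//.
by rewrite pnatr_eq0 -lt0n.
Qed.

(** The second moment of the averaged likelihood ratio is the mean of [c] over pairs, so the
    hypothesis on [c] bounds it by [1 + eta]. *)
Lemma avg_testing_lower_bound (P : probability T R) (X : finType) (C : {set X})
    (f : X -> T -> R) (c : X -> X -> R) A (e eta : R) :
  measurable A -> (0 < #|C|)%N ->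
  (forall S, measurable_fun setT (f S)) -> (forall S x, 0 <= f S x) ->
  (forall S, \int[P]_x (f S x)%:E = 1)%E ->
  (forall S S', \int[P]_x (f S x * f S' x)%:E = (c S S')%:E)%E ->
  \sum_(S in C) \sum_(S' in C) c S S' <= #|C|%:R ^+ 2 * (1 + eta) -> 0 < e ->
  ((1 - e - eta / (4 * e))%:E <=
   \int[P]_x (error_density A (fun x => #|C|%:R^-1 * \sum_(S in C) f S x) x)%:E)%E.
Proof.
move=> mA C0 mf f0 f1 fc cC e0; apply: testing_lower_bound => //.
- by apply: measurable_funM => //; exact: measurable_sum_in.
- by move=> x; rewrite mulr_ge0// sumr_ge0.
- exact: integral_avg.
rewrite (integral_avg_sqr C mf f0 fc) lee_fin ler_pdivrMl//.
by rewrite exprn_gt0// ltr0n.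
Qed.

End testing.

(** From 1 - x <= exp(-x) follows exp(x) (1 - x) <= 1, while (1 + 2x)(1 - x) >= 1 on [0, 1/2]. *)
Lemma expRB1_le (R : realType) (x : R) : 0 <= x <= 1 / 2 -> expR x - 1 <= 2 * x.
Proof.
move=> /andP[x0 x2].
have h : expR x * (1 - x) <= 1.
  by rewrite -[leRHS](expRxMexpNx_1 x) ler_pM2l ?expR_gt0// expR_ge1Dx.
rewrite lerBlDr leNgt; apply/negP => hx.
have : (2 * x + 1) * (1 - x) < expR x * (1 - x) by rewrite ltr_pM2r//; lra.
nra.
Qed.

Lemma exprn_le_expR (R : realType) (x : R) n : 0 <= 1 + x ->
  (1 + x) ^+ n <= expR (n%:R * x).
Proof. by move=> x0; rewrite expRM_natl lerXn2r// ?nnegrE ?expR_ge0// expR_ge1Dx. Qed.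

(** * The risk as an integral, and its bound for regime (i) *)

Section detection.
Context (R : realType).
Variables (s n : nat) (alpha : {i01 R}) (beta : R).
Local Notation C := (perfect_matchings s).

Lemma perfect_matchings_gt0 : (0 < #|C|)%N.
Proof. by rewrite card_perfect_matchings fact_gt0. Qed.

Lemma riskE (phi : test R n (s ^ 2)) : risk alpha beta C phi =
  (\int[iid n (P0 R (s ^ 2))]_X (error_density [set X | phi X = true]
    (fun X => #|C|%:R^-1 *
       \sum_(S in C) \prod_(i < n) mix_lr alpha beta S (tnth X i)) X)%:E)%E.
Proof.
rewrite -(@is_density_error _ _ R _ _ C (fun S => iid n (PS alpha beta S))).
- rewrite /risk; congr (_ + _ * _)%E; apply: eq_bigr => S _; congr (iid _ _ _).
  by apply/seteqP; split => X /=; case: (phi X).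
- by rewrite -[X in measurable X]setTI; exact: (measurable_funP phi _ [set true]).
- move=> S; apply: (is_density_tuple_prob (f := fun=> mix_lr alpha beta S)) => i.
  exact: is_density_mix_lr.
Qed.

Lemma risk_lb_mixture (phi : test R n (s ^ 2)) (e : R) : 0 < e ->
  beta ^+ 2 * s%:R <= 1 / 2 ->
  beta ^+ 2 * alpha%:num ^+ 2 * n%:R <= 1 / 8 ->
  ((1 - e - 2 * (beta ^+ 2 * alpha%:num ^+ 2 * n%:R) / e)%:E <=
    risk alpha beta C phi)%E.
Proof.
move=> e0 bs ban; rewrite riskE.
set t := beta ^+ 2 * alpha%:num ^+ 2 * n%:R in ban *.
have t0 : 0 <= t by exact: mulr_ge0 (mulr_ge0 (sqr_ge0 _) (sqr_ge0 _)) (ler0n _ _).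
have DS (S : {set 'I_(s ^ 2)}) := is_density_mix_lr alpha beta S.
have mS (S : {set 'I_(s ^ 2)}) : measurable_fun setT (mix_lr alpha beta S) by case: (DS S).
have S0 (S : {set 'I_(s ^ 2)}) x : 0 <= mix_lr alpha beta S x by case: (DS S).
pose c (S S' : {set 'I_(s ^ 2)}) :=
  (1 + alpha%:num ^+ 2 * (expR (beta ^+ 2) ^+ #|S :&: S'|%SET - 1)) ^+ n.
(* The second moment method is applied with [eta = 8 * t]. *)
have -> : 2 * t / e = (8 * t) / (4 * e) by field; rewrite gt_eqF.
apply: (avg_testing_lower_bound (c := c)) => //.
- by rewrite -[X in measurable X]setTI; exact: (measurable_funP phi _ [set true]).
- exact: perfect_matchings_gt0.
- by move=> S; exact: (measurable_prod_tnth (f := fun=> mix_lr alpha beta S)).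
- by move=> S X; exact: prodr_ge0.
- move=> S; rewrite (ge0_integral_prod_tnth _ (f := fun=> mix_lr alpha beta S))//.
  by rewrite big1// => i _; exact: is_density_integral1 (DS S).
- move=> S S'; rewrite (ge0_integral_prod_tnthM (fun=> P0 R (s ^ 2))
    (f := fun=> mix_lr alpha beta S) (g := fun=> mix_lr alpha beta S'))//.
  rewrite (eq_bigr _ (fun i _ => integral_mix_lrM alpha beta S S')) prodEFin.
  by rewrite prodr_const card_ord.
have z1 : 1 <= expR (2 * t) by rewrite -[leLHS]expR0 ler_expR mulr_ge0.
(* As beta^2 K <= beta^2 s <= 1/2, exp(beta^2 K) - 1 is at most 2 beta^2 K, so each [c S S'] is at
   most exp(2 n alpha^2 beta^2 K) = exp(2t)^K. *)
apply: (@le_trans _ _ (\sum_(S in C) \sum_(S' in C) expR (2 * t) ^+ #|S :&: S'|%SET)).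
  apply: ler_sum => S CS; apply: ler_sum => S' _; rewrite /c -!expRM_natl.
  set k := #|_|%:R : R.
  have kb : 0 <= k * beta ^+ 2 <= 1 / 2.
    rewrite mulr_ge0 ?sqr_ge0//=; apply: le_trans bs.
    rewrite mulrC ler_wpM2l ?sqr_ge0// ler_nat.
    rewrite -[leqRHS](card_perfect_matching CS).
    exact/subset_leq_card/finset.subsetIl.
  have eb1 : 0 <= expR (k * beta ^+ 2) - 1.
    by rewrite subr_ge0 -[leLHS]expR0 ler_expR; case/andP: kb.
  apply: le_trans (exprn_le_expR _ _) _.
    by rewrite addr_ge0// mulr_ge0 ?sqr_ge0.
  rewrite ler_expR; have := expRB1_le kb => le_e.
  have : n%:R * (alpha%:num ^+ 2 * (expR (k * beta ^+ 2) - 1)) <=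
         n%:R * (alpha%:num ^+ 2 * (2 * (k * beta ^+ 2))).
    by rewrite !ler_wpM2l ?sqr_ge0.
  move=> /le_trans; apply; rewrite le_eqVlt; apply/orP; left; apply/eqP.
  by rewrite /t; ring.
apply: le_trans (sum_perfect_matchingsI_le s z1) _.
rewrite ler_wpM2l ?sqr_ge0// -lerBlDl.
(* Two uses of [expRB1_le] give exp(exp(2t) - 1) <= 1 + 8t; the second needs 4t <= 1/2, which is
   where the threshold 1/8 comes from. *)
have h1 : expR (2 * t) - 1 <= 4 * t.
  by have := @expRB1_le R (2 * t); lra.
have h0 : 0 <= expR (2 * t) - 1 by rewrite subr_ge0.
have := @expRB1_le R (expR (2 * t) - 1); lra.
Qed.

End detection.

(** * The random set of shifted rows *)

Section labels.
Context (R : realType).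
Variables (n : nat) (a : R).

(** The probability of [xi] when each row is shifted independently with probability [a]. *)
Definition label_weight (xi : {set 'I_n}) : R :=
  \prod_(i < n) (if i \in xi then a else 1 - a).

Lemma sum_label_weight_prod (f : 'I_n -> R) :
  \sum_(xi : {set 'I_n}) label_weight xi * \prod_(i < n) (if i \in xi then f i else 1)
  = \prod_(i < n) (1 - a + a * f i).
Proof.
under [RHS]eq_bigr do rewrite addrC.
rewrite bigA_distr; apply: eq_bigr => xi _; rewrite -big_split/=.
by apply: eq_bigr => i _; case: ifP; rewrite ?mulr1.
Qed.

(** The generating function of the binomial variable |xi|. *)
Lemma sum_label_weight_exp (z : R) :
  \sum_(xi : {set 'I_n}) label_weight xi * z ^+ #|xi| = (1 + a * (z - 1)) ^+ n.
Proof.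
transitivity (\prod_(i < n) (1 - a + a * z)).
  rewrite -(sum_label_weight_prod (fun=> z)); apply: eq_bigr => xi _.
  by rewrite -prodr_const big_mkcond.
by rewrite prodr_const card_ord; congr (_ ^+ n); ring.
Qed.

Lemma sum_label_weight : \sum_(xi : {set 'I_n}) label_weight xi = 1.
Proof.
have := sum_label_weight_exp 1; rewrite subrr mulr0 addr0 expr1n => <-.
by apply: eq_bigr => xi _; rewrite expr1n mulr1.
Qed.

Lemma label_weight_ge0 (xi : {set 'I_n}) : 0 <= a <= 1 -> 0 <= label_weight xi.
Proof. by move=> /andP[a0 a1]; apply: prodr_ge0 => i _; case: ifP; lra. Qed.

End labels.

(** * The bound on the risk for regime (ii) *)

Section detection_labels.
Context (R : realType).
Variables (s n : nat) (alpha : {i01 R}) (beta : R).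
Local Notation C := (perfect_matchings s).

(* The likelihood ratio of row [i] when the set [xi] of the shifted rows is
   known. *)
Definition label_lr (xi : {set 'I_n}) (S : {set 'I_(s ^ 2)}) (i : 'I_n) :
    (s ^ 2).-tuple (measurableTypeR R) -> R :=
  fun x => if i \in xi then gauss_lr beta S x else 1.

Lemma measurable_label_lr xi S i : measurable_fun setT (label_lr xi S i).
Proof.
rewrite /label_lr; case: (i \in xi) => //.
by case: (is_density_gauss_lr beta S).
Qed.

Lemma label_lr_ge0 xi S i x : 0 <= label_lr xi S i x.
Proof.
rewrite /label_lr; case: (i \in xi) => //.
by case: (is_density_gauss_lr beta S).
Qed.

Definition avg_label_lr (xi : {set 'I_n})
    (X : n.-tuple ((s ^ 2).-tuple (measurableTypeR R))) : R :=
  #|C|%:R^-1 * \sum_(S in C) \prod_(i < n) label_lr xi S i (tnth X i).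

(** [error_density] is affine in its second argument and the weights sum to 1, so it commutes with
    the mixture over [xi]. *)
Lemma error_density_labels A X :
  error_density A (fun X => #|C|%:R^-1 *
       \sum_(S in C) \prod_(i < n) mix_lr alpha beta S (tnth X i)) X =
  \sum_(xi : {set 'I_n}) label_weight alpha%:num xi * error_density A (avg_label_lr xi) X.
Proof.
rewrite /error_density.
under [RHS]eq_bigr do rewrite mulrDr mulrCA.
rewrite big_split/= -mulr_suml sum_label_weight mul1r; congr (_ + _).
rewrite -mulr_sumr; congr (_ * _).
rewrite /avg_label_lr; under [RHS]eq_bigr do rewrite mulrCA.
rewrite -mulr_sumr; congr (_ * _).
under [RHS]eq_bigr do rewrite mulr_sumr.
rewrite exchange_big/=; apply: eq_bigr => S _.
by rewrite sum_label_weight_prod.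
Qed.

(** The second moment method is used when z - 1 <= c, with z = exp(beta^2 |xi|). The last term (z -
    1) / c dominates the indicator of the opposite case, so that the bound holds for every [xi] and
    can be averaged. *)
Lemma label_lr_testing (xi : {set 'I_n}) A (e c : R) : measurable A ->
  0 < e -> 0 < c <= 1 / 2 ->
  ((1 - e - c / (2 * e) - (expR (beta ^+ 2) ^+ #|xi| - 1) / c)%:E <=
   \int[iid n (P0 R (s ^ 2))]_X (error_density A (avg_label_lr xi) X)%:E)%E.
Proof.
move=> mA e0 /andP[c0 c12]; set z := expR _ ^+ _.
have z1 : 1 <= z by rewrite exprn_ege1// -[leLHS]expR0 ler_expR sqr_ge0.
have DS (S : {set 'I_(s ^ 2)}) := is_density_gauss_lr beta S.
have mS := measurable_label_lr xi; have S0 := label_lr_ge0 xi.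
(* Otherwise the claimed bound is negative. *)
have [zc|cz] := leP (z - 1) c; last first.
  apply: (@le_trans _ _ 0%E); last first.
    apply: integral_ge0 => X _; rewrite lee_fin error_density_ge0// => Y.
    by rewrite mulr_ge0// sumr_ge0// => S _; exact: prodr_ge0.
  have : 1 < (z - 1) / c by rewrite ltr_pdivlMr// mul1r.
  have : 0 < c / (2 * e) by rewrite divr_gt0// mulr_gt0.
  rewrite lee_fin; lra.
have zc0 : 0 <= (z - 1) / c by rewrite divr_ge0// ?subr_ge0// ltW.
(* Given [xi], the second moment is E[z^K] <= exp(z - 1), so its excess over 1 is at most 2(z - 1)
   <= 2c. *)
have eta : expR (z - 1) - 1 <= 2 * c.
  by have := @expRB1_le R (z - 1); lra.
apply: (@le_trans _ _ (1 - e - (2 * c) / (4 * e))%:E).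
  have -> : 2 * c / (4 * e) = c / (2 * e) by field; rewrite gt_eqF.
  by rewrite lee_fin; lra.
apply: (avg_testing_lower_bound (c := fun S S' => z ^+ #|S :&: S'|%SET)) => //.
- exact: perfect_matchings_gt0.
- by move=> S; exact: measurable_prod_tnth.
- by move=> S X; exact: prodr_ge0.
- move=> S; rewrite (ge0_integral_prod_tnth _ (f := label_lr xi S))//.
  rewrite big1// => i _; rewrite /label_lr; case: (i \in xi).
    exact: is_density_integral1 (DS S).
  exact: is_density_integral1 (is_density_id (P0 R (s ^ 2))).
- move=> S S'; rewrite (ge0_integral_prod_tnthM (fun=> P0 R (s ^ 2))
    (f := label_lr xi S) (g := label_lr xi S'))//.
  rewrite -exprM mulnC exprM -[in RHS]prodr_const [in RHS]big_mkcond/= -prodEFin.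
  apply: eq_bigr => i _; rewrite /label_lr; case: (i \in xi).
    exact: integral_gauss_lrM.
  under eq_integral do rewrite mulr1.
  exact: is_density_integral1 (is_density_id (P0 R (s ^ 2))).
apply: le_trans (sum_perfect_matchingsI_le s z1) _.
by rewrite ler_wpM2l ?sqr_ge0// -lerBlDl.
Qed.

Lemma risk_lb_labels (phi : test R n (s ^ 2)) (e c : R) :
  0 < e -> 0 < c <= 1 / 2 -> beta ^+ 2 <= 1 / 2 ->
  beta ^+ 2 * alpha%:num * n%:R <= 1 / 4 ->
  ((1 - e - c / (2 * e) - 4 * (beta ^+ 2 * alpha%:num * n%:R) / c)%:E <=
    risk alpha beta C phi)%E.
Proof.
move=> e0 c01 b1 ban; rewrite riskE; set A := [set X | phi X = true].
have /andP[c0 _] := c01.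
have mA : measurable A.
  by rewrite -[X in measurable X]setTI; exact: (measurable_funP phi _ [set true]).
have avg0 xi X : 0 <= avg_label_lr xi X.
  rewrite mulr_ge0// sumr_ge0// => S _.
  by apply: prodr_ge0 => i _; exact: label_lr_ge0.
have mavg xi : measurable_fun setT (avg_label_lr xi).
  apply: measurable_funM => //; apply: measurable_sum_in => S.
  by apply: measurable_prod_tnth => i; exact: measurable_label_lr.
have a01 : 0 <= alpha%:num <= 1 by apply/andP.
have w0 (xi : {set 'I_n}) := label_weight_ge0 xi a01.
have mE xi : measurable_fun setT (fun X => (error_density A (avg_label_lr xi) X)%:E).
  by apply/measurable_EFinP; exact: measurable_error_density.
rewrite (eq_integral (fun X => \sum_(xi : {set 'I_n})
  ((label_weight alpha%:num xi)%:E * (error_density A (avg_label_lr xi) X)%:E))%E); last first.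
  move=> X _; rewrite error_density_labels -sumEFin.
  by apply: eq_bigr => xi _; rewrite EFinM.
rewrite ge0_integral_sum//; last 2 first.
- by move=> xi; exact: measurable_funeM.
- by move=> xi X _; rewrite mule_ge0// lee_fin// error_density_ge0.
(* Markov's inequality for [expR (beta ^+ 2) ^+ #|xi| - 1], [xi] being random
   with the weights [label_weight]. *)
pose K : R := 1 - e - c / (2 * e) + c^-1.
apply: (@le_trans _ _ (\sum_(xi : {set 'I_n}) label_weight alpha%:num xi *
    (K - expR (beta ^+ 2) ^+ #|xi| / c))%:E).
  rewrite lee_fin; under eq_bigr do rewrite mulrBr mulrA.
  rewrite big_split/= -mulr_suml sum_label_weight mul1r sumrN -mulr_suml.
  rewrite sum_label_weight_exp.
  have b0 : 0 <= beta ^+ 2 <= 1 / 2 by rewrite sqr_ge0.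
  have eb := expRB1_le b0.
  have eb0 : 0 <= expR (beta ^+ 2) - 1.
    by rewrite subr_ge0 -[leLHS]expR0 ler_expR sqr_ge0.
  set t := beta ^+ 2 * alpha%:num * n%:R in ban *.
  have t0 : 0 <= t by exact: mulr_ge0 (mulr_ge0 (sqr_ge0 _) _) (ler0n _ _).
  (* The mean of exp(beta^2 |xi|) is at most exp(n alpha (exp(beta^2) - 1)) <= exp(2t) <= 1 + 4t,
     the last step using t <= 1/4. *)
  have h : (1 + alpha%:num * (expR (beta ^+ 2) - 1)) ^+ n <= 1 + 4 * t.
    apply: le_trans (exprn_le_expR _ _) _; first by rewrite addr_ge0// mulr_ge0.
    have : 0 <= 2 * t <= 1 / 2 by lra.
    move=> /expRB1_le h2; suff : expR (n%:R * (alpha%:num * (expR (beta ^+ 2) - 1))) <= expR (2 * t).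
      by lra.
    rewrite ler_expR /t.
    have -> : 2 * (beta ^+ 2 * alpha%:num * n%:R) = n%:R * (alpha%:num * (2 * beta ^+ 2)).
      by ring.
    by rewrite !ler_wpM2l.
  have : (1 + alpha%:num * (expR (beta ^+ 2) - 1)) ^+ n / c <= (1 + 4 * t) / c.
    by rewrite ler_pM2r// invr_gt0.
  rewrite /K mulrDl mul1r; lra.
rewrite -sumEFin; apply: lee_sum => xi _.
rewrite ge0_integralZl//; last 2 first.
- by move=> X _; rewrite lee_fin error_density_ge0.
- by rewrite lee_fin.
rewrite EFinM; apply: lee_wpmul2l; first by rewrite lee_fin.
apply: le_trans (label_lr_testing xi mA e0 c01).
by rewrite lee_fin /K mulrBl mul1r; lra.
Qed.

End detection_labels.

(* The sequences are indexed by s = sqrt d, i.e. by the perfect squares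
   d = s ^ 2, and s^* = s. *)
Theorem corollary5p8 (R : realType)
    (n : nat -> nat) (alpha : nat -> {i01 R}) (beta : nat -> R)
    (alpha_gt0 : forall s, 0 < (alpha s)%:num)
    (beta_gt0 : forall s, 0 < beta s)
    (n_oo : n @ \oo --> \oo)
    (alpha_n_oo : (fun s => (alpha s)%:num * (n s)%:R) @ \oo --> +oo)
    (beta_0 : beta @ \oo --> 0)
    (regime :
      ((fun s => beta s ^+ 2 * (alpha s)%:num ^+ 2 * (n s)%:R) @ \oo --> 0 /\
       (fun s => beta s ^+ 2 * s%:R) @ \oo --> 0) \/
      (beta @ \oo --> 0 /\
       (fun s => beta s ^+ 2 * (alpha s)%:num * (n s)%:R) @ \oo --> 0))
    (delta : R) (delta_gt0 : 0 < delta) :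
  \forall s \near \oo,
    ((1 - delta)%:E <=
      ereal_inf [set risk (alpha s) (beta s) (perfect_matchings s) phi
                | phi in [set: test R (n s) (s ^ 2)]])%E.
Proof.
have near_le (u : nat -> R) k : 0 < k -> u @ \oo --> 0 -> \forall s \near \oo, u s <= k.
  move=> k0 /cvgr0Pnorm_le /(_ k k0); apply: filterS => s; exact: le_trans (ler_norm _).
case: regime => [[ban bs]|[_ ban]].
  (* With [e = delta / 2], the cap [delta ^+ 2 / 8] on t makes 2t / e at most [delta / 2]. *)
  have d8 : 0 < Num.min (1 / 8) (delta ^+ 2 / 8).
    by rewrite lt_min !divr_gt0// exprn_gt0.
  near=> s; apply: le_ereal_inf_tmp => _ [phi _ <-].
  have bs' : beta s ^+ 2 * s%:R <= 1 / 2 by near: s; apply: near_le.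
  have : beta s ^+ 2 * (alpha s)%:num ^+ 2 * (n s)%:R <= Num.min (1 / 8) (delta ^+ 2 / 8).
    by near: s; exact: near_le.
  rewrite le_min => /andP[t1 t2].
  have d2 : 0 < delta / 2 by rewrite divr_gt0.
  apply: le_trans (risk_lb_mixture phi d2 bs' t1); rewrite lee_fin.
  have : 2 * (beta s ^+ 2 * (alpha s)%:num ^+ 2 * (n s)%:R) / (delta / 2) <= delta / 2.
    by rewrite ler_pdivrMr//; move: t2; rewrite expr2; lra.
  lra.
(* With [e = delta / 3], the three losses e, c / (2e) and 4t / c are each at most [delta / 3]: this
   fixes the cap on [c], then the cap [c * delta / 12] on t. *)
pose c := Num.min (1 / 2) (2 * delta ^+ 2 / 9).
have c0 : 0 < c by rewrite lt_min !divr_gt0// mulr_gt0// exprn_gt0.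
have c12 : 0 < c <= 1 / 2 by rewrite c0 ge_min lexx.
have cd : c <= 2 * delta ^+ 2 / 9 by rewrite ge_min lexx orbT.
have k0 : 0 < Num.min (1 / 4) (c * delta / 12).
  by rewrite lt_min !divr_gt0// mulr_gt0.
have d3 : 0 < delta / 3 by rewrite divr_gt0.
near=> s; apply: le_ereal_inf_tmp => _ [phi _ <-].
have b1 : beta s ^+ 2 <= 1 / 2.
  have : beta s <= 1 / 2 by near: s; apply: near_le.
  have := beta_gt0 s; rewrite expr2; nra.
have : beta s ^+ 2 * (alpha s)%:num * (n s)%:R <= Num.min (1 / 4) (c * delta / 12).
  by near: s; exact: near_le.
rewrite le_min => /andP[t1 t2].
apply: le_trans (risk_lb_labels phi d3 c12 b1 t1); rewrite lee_fin.
have : c / (2 * (delta / 3)) <= delta / 3.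
  by rewrite ler_pdivrMr ?mulr_gt0//; move: cd; rewrite expr2; lra.
have : 4 * (beta s ^+ 2 * (alpha s)%:num * (n s)%:R) / c <= delta / 3.
  by rewrite ler_pdivrMr//; lra.
lra.
Unshelve. all: by end_near.
Qed.
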